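(* Let $\varphi$ be a unital linear functional on $\mathbb{C}\langle x_1,\ldots,x_d\rangle$, $M$ its moment generating function, and $R,\eta$ its free, respectively Boolean, cumulant generating functions. Then $$\bigl(1-\mathbf{x}\cdot\mathbf{U}+R(\mathbf{U})\bigr)^{-1}=(1-\mathbf{x}\cdot\mathbf{V})^{-1}(1-\eta(\mathbf{V})),$$ where $\mathbf{U}=(U_1,\ldots,U_d)$ and $\mathbf{V}=(V_1,\ldots,V_d)$ are two $d$-tuples of non-commutative power series, with zero constant terms, related by $$\mathbf{U}=(1+M(\mathbf{V}))\mathbf{V}\qquad\text{and}\qquad\mathbf{V}=(1+R(\mathbf{U}))^{-1}\mathbf{U},$$ that is, $U_i=(1+M(\mathbf{V}))V_i$ and $V_i=(1+R(\mathbf{U}))^{-1}U_i$ for each $i$.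
   Context: $\mathbb{C}\langle x_1,\ldots,x_d\rangle$ is the algebra of polynomials in non-commuting variables, $\mathbf{x}=(x_1,\ldots,x_d)$. $\mathbf{U},\mathbf{V}$ are tuples of formal power series in non-commuting indeterminates $\mathbf{z}=(z_1,\ldots,z_d)$, which commute with the $x_i$; $\mathbf{x}\cdot\mathbf{U}=\sum_ix_iU_i$; inverses are multiplicative inverses of formal power series. For multi-indices $\vec u\in\{1,\ldots,d\}^n$, $x_{\vec u}=x_{u(1)}\cdots x_{u(n)}$, $|\vec u|=n$, and $z_{\vec u}$ similarly. $M(\mathbf{z})=\sum_{|\vec u|\ge1}\varphi[x_{\vec u}]z_{\vec u}$. The Boolean (resp. free) cumulant functional $\eta$ (resp. $R$) is the linear functional with value $0$ on $1$ determined, for $|\vec u|=n\ge1$, by $$\varphi[x_{\vec u}]=\sum_{\pi\in\mathrm{Int}(n)}\prod_{B\in\pi}\eta\Big[\prod_{i\in B}x_{u(i)}\Big]\quad\Big(\text{resp. } \varphi[x_{\vec u}]=\sum_{\pi\in\mathrm{NC}(n)}\prod_{B\in\pi}R\Big[\prod_{i\in B}x_{u(i)}\Big]\Big),$$ with $\mathrm{Int}(n)$ the interval partitions and $\mathrm{NC}(n)$ the non-crossing partitions of $\{1,\ldots,n\}$ (products taken in increasing order of $i$). The generating functions are $\eta(\mathbf{z})=\sum_{|\vec u|\ge1}\eta[x_{\vec u}]z_{\vec u}$ and $R(\mathbf{z})=\sum_{|\vec u|\ge1}R[x_{\vec u}]z_{\vec u}$. *)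

(* Defs.v *)
From HB Require Import structures.
From mathcomp Require Import all_boot all_order all_algebra.
From mathcomp Require Import boolp reals complex.
From mathcomp.multinomials Require Import monalg.

Set Implicit Arguments.
Unset Strict Implicit.
Unset Printing Implicit Defensive.

Import GRing.Theory.
Local Open Scope ring_scope.

(** [ncseries A d] is A<<z_1, ..., z_d>>: the coefficient of z_{u(1)}...z_{u(n)}
  is the value at the word [:: u(1); ...; u(n)].  Coefficients and
  indeterminates commute: (a z_u)(b z_v) = (a b) z_{uv}. *)

Record ncseries (A : Type) (d : nat) := NCSeries { ncoef :> seq 'I_d -> A }.

Section SeriesRing.
Context (A : nzRingType) (d : nat).
Local Notation S := (ncseries A d).
Implicit Types (f g h : S) (w : seq 'I_d).

HB.instance Definition _ := gen_eqMixin S.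
HB.instance Definition _ := gen_choiceMixin S.

Lemma ncseriesP f g : f =1 g -> f = g.
Proof. by case: f g => [f] [g] /= /funext ->. Qed.

Definition nczero : S := NCSeries (fun _ => 0).
Definition ncopp f : S := NCSeries (fun w => - f w).
Definition ncadd f g : S := NCSeries (fun w => f w + g w).
Definition ncconst (a : A) : S := NCSeries (fun w => if w is [::] then a else 0).
Definition ncmul f g : S :=
  NCSeries (fun w => \sum_(k < (size w).+1) f (take k w) * g (drop k w)).

Fact ncaddA : associative ncadd.
Proof. by move=> f g h; apply: ncseriesP => w /=; rewrite addrA. Qed.
Fact ncaddC : commutative ncadd.
Proof. by move=> f g; apply: ncseriesP => w /=; rewrite addrC. Qed.
Fact ncadd0 : left_id nczero ncadd.
Proof. by move=> f; apply: ncseriesP => w /=; rewrite add0r. Qed.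
Fact ncaddN : left_inverse nczero ncopp ncadd.
Proof. by move=> f; apply: ncseriesP => w /=; rewrite addNr. Qed.

HB.instance Definition _ :=
  GRing.isZmodule.Build S ncaddA ncaddC ncadd0 ncaddN.

Let shift (a : 'I_d) f : S := NCSeries (fun w => f (a :: w)).

Let ncmul_nil f g : ncmul f g [::] = f [::] * g [::].
Proof. by rewrite /= big_ord1. Qed.

Let ncmul_cons f g a w :
  ncmul f g (a :: w) = f [::] * g (a :: w) + ncmul (shift a f) g w.
Proof. by rewrite /= big_ord_recl. Qed.

Fact ncmulDl : left_distributive ncmul ncadd.
Proof.
move=> f g h; apply: ncseriesP => w /=.
by rewrite -big_split; apply: eq_bigr => k _; rewrite mulrDl.
Qed.

Fact ncmulDr : right_distributive ncmul ncadd.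
Proof.
move=> f g h; apply: ncseriesP => w /=.
by rewrite -big_split; apply: eq_bigr => k _; rewrite mulrDr.
Qed.

Let ncmul_scale a f g w :
  ncmul (NCSeries (fun v => a * f v)) g w = a * ncmul f g w.
Proof. by rewrite /= mulr_sumr; apply: eq_bigr => k _; rewrite mulrA. Qed.

Fact ncmulA : associative ncmul.
Proof.
move=> f g h; apply: ncseriesP => w.
elim: w f g => [|a w IH] f g; first by rewrite !ncmul_nil mulrA.
have shiftM : shift a (ncmul f g) =
    ncadd (NCSeries (fun v => f [::] * shift a g v)) (ncmul (shift a f) g).
  by apply: ncseriesP => v; rewrite [LHS]ncmul_cons.
have addE (p q : S) v : ncadd p q v = p v + q v by [].
rewrite !(ncmul_cons _ _ a w) ncmul_nil shiftM ncmulDl addE ncmul_scale mulrDr.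
by rewrite IH mulrA addrA.
Qed.

Fact ncmul1 : left_id (ncconst 1) ncmul.
Proof.
move=> f; apply: ncseriesP => -[|a w]; first by rewrite ncmul_nil mul1r.
by rewrite ncmul_cons /= mul1r big1 ?addr0 // => k _; rewrite mul0r.
Qed.

Fact ncmulr1 : right_id (ncconst 1) ncmul.
Proof.
move=> f; apply: ncseriesP => w; elim: w f => [|a w IH] f.
  by rewrite ncmul_nil mulr1.
by rewrite ncmul_cons IH /= mulr0 add0r.
Qed.

Fact ncone_neq0 : ncconst 1 != 0.
Proof.
apply/eqP => /(congr1 (fun f : S => f [::])) /= /eqP.
by rewrite oner_eq0.
Qed.

HB.instance Definition _ := GRing.Zmodule_isNzRing.Build S
  ncmulA ncmul1 ncmulr1 ncmulDl ncmulDr ncone_neq0.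

Definition ncinvertible f := exists g, g * f = 1 /\ f * g = 1.
Definition ncunit : pred S := fun f => `[< ncinvertible f >].
Definition ncinv f : S :=
  if pselect (ncinvertible f) is left fV then projT1 (cid fV) else f.

Fact ncmulVr : {in ncunit, left_inverse 1 ncinv *%R}.
Proof.
move=> f /asboolP fV; rewrite /ncinv.
by case: pselect => // fV'; case: (cid fV') => g [].
Qed.

Fact ncmulrV : {in ncunit, right_inverse 1 ncinv *%R}.
Proof.
move=> f /asboolP fV; rewrite /ncinv.
by case: pselect => // fV'; case: (cid fV') => g [].
Qed.

Fact ncunitP f g : g * f = 1 /\ f * g = 1 -> ncunit f.
Proof. by move=> fV; apply/asboolP; exists g. Qed.

Fact ncinv_out : {in [predC ncunit], ncinv =1 id}.
Proof. by move=> f /asboolPn; rewrite /ncinv; case: pselect. Qed.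

(* [f^-1] is the two-sided multiplicative inverse of [f]; [ncunit_const1] shows
   that it is a genuine one whenever the constant term of [f] is 1. *)
HB.instance Definition _ := GRing.NzRing_hasMulInverse.Build S
  ncmulVr ncmulrV ncunitP ncinv_out.

Let pow_small f n w : f [::] = 0 -> (size w < n)%N -> (f ^+ n) w = 0.
Proof.
move=> f0; elim: n w => // n IH w lt_wn; rewrite exprS.
case: w lt_wn => [|a w] lt_wn; first by rewrite [LHS]ncmul_nil f0 mul0r.
rewrite [LHS]ncmul_cons f0 mul0r add0r /= big1 // => k _.
by rewrite IH ?mulr0 // size_drop; apply: leq_ltn_trans (leq_subr _ _) _.
Qed.

Let sumE (I : Type) (r : seq I) (F : I -> S) w :
  (\sum_(i <- r) F i) w = \sum_(i <- r) F i w.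
Proof. exact: (big_morph (fun f : S => f w)). Qed.

Lemma ncunit_const1 f : f [::] = 1 -> f \is a GRing.unit.
Proof.
move=> f1; pose e := 1 - f.
have e0 : e [::] = 0 by rewrite /e /= f1 subrr.
have -> : f = 1 - e by rewrite /e opprB addrC subrK.
pose g : S := NCSeries (fun w => \sum_(n < (size w).+1) (e ^+ n) w).
have gE N w : (size w < N)%N -> g w = (\sum_(n < N) e ^+ n) w.
  move=> lt_wN; rewrite sumE /= -(subnKC lt_wN) big_split_ord /=.
  rewrite [X in _ + X]big1 ?addr0 // => i _.
  by apply: pow_small => //; rewrite ltnS leq_addr.
have geo N : (1 - e) * \sum_(n < N) e ^+ n = 1 - e ^+ N.
  by rewrite -opprB mulNr -subrX1 opprB.
have geo' N : (\sum_(n < N) e ^+ n) * (1 - e) = 1 - e ^+ N.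
  rewrite -geo; apply: commr_sym; apply: commr_sum => i _.
  by apply: commrX; apply: commr_sym; apply: commrB; rewrite ?commr_refl //; apply: commr1.
apply/unitrP; exists g; split; apply: ncseriesP => w.
  have -> : (g * (1 - e)) w = ((\sum_(n < (size w).+1) e ^+ n) * (1 - e)) w.
    apply: eq_bigr => k _; congr (_ * _); apply: gE.
    by rewrite ltnS size_take_min geq_minr.
  by rewrite geo' /= -[RHS]subr0; congr (_ - _); apply: pow_small.
have -> : ((1 - e) * g) w = ((1 - e) * (\sum_(n < (size w).+1) e ^+ n)) w.
  apply: eq_bigr => k _; congr (_ * _); apply: gE.
  by rewrite ltnS size_drop leq_subr.
by rewrite geo /= -[RHS]subr0; congr (_ - _); apply: pow_small.
Qed.

End SeriesRing.

(** f(U) = \sum_u f_u U_{u(1)} ... U_{u(n)}.  The sum is cut at |u| <= |w| in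
  the coefficient of z_w, which loses nothing when the [U i] have zero constant
  terms, the only case in which f(U) is meant: see [ncsubst_stable]. *)
Definition ncsubst (K : comNzRingType) (d : nat)
    (f : ncseries K d) (U : 'I_d -> ncseries K d) : ncseries K d :=
  NCSeries (fun w => \sum_(n < (size w).+1) \sum_(u : n.-tuple 'I_d)
    f u * (\prod_(i <- u) U i) w).

Lemma ncprod_small (K : nzRingType) d (U : 'I_d -> ncseries K d) (u w : seq 'I_d) :
  (forall i, U i [::] = 0) -> (size w < size u)%N -> (\prod_(i <- u) U i) w = 0.
Proof.
move=> U0; elim: u w => // a u IH w lt_wu; rewrite big_cons [LHS]/=.
rewrite big_ord_recl take0 U0 mul0r add0r; apply: big1 => k _.
rewrite IH ?mulr0 // size_drop -ltnS; apply: leq_trans lt_wu.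
case: w k => [[]//|b w k] /=; rewrite /bump /= add1n subSS.
by rewrite !ltnS leq_subr.
Qed.

Lemma ncsubst_stable (K : comNzRingType) d (f : ncseries K d)
    (U : 'I_d -> ncseries K d) (w : seq 'I_d) (N : nat) :
    (forall i, U i [::] = 0) -> (size w < N)%N ->
  ncsubst f U w = \sum_(n < N) \sum_(u : n.-tuple 'I_d)
    f u * (\prod_(i <- u) U i) w.
Proof.
move=> U0 lt_wN; rewrite /= -(subnKC lt_wN) big_split_ord /=.
rewrite [X in _ = _ + X]big1 ?addr0 // => i _; apply: big1 => u _.
by rewrite ncprod_small ?mulr0 // size_tuple ltnS leq_addr.
Qed.

(** K<x_1, ..., x_d> is the algebra of the free monoid on 'I_d. *)
Notation ncpoly K d := {malg K[{fmonom 'I_d}]}.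

Definition ncX (K : comNzRingType) (d : nat) (i : 'I_d) : ncpoly K d :=
  << fmu i >>.

(** The inclusion of K<<z>> in K<x><<z>>. *)
Definition nclift (K : comNzRingType) (d : nat) (f : ncseries K d) :
    ncseries (ncpoly K d) d :=
  NCSeries (fun w => (f w)%:MP).

(** x . U = \sum_i x_i U_i *)
Definition ncdot (K : comNzRingType) (d : nat) (U : 'I_d -> ncseries K d) :
    ncseries (ncpoly K d) d :=
  \sum_(i < d) ncconst d (ncX K i) * nclift (U i).

(** \sum_{|u| >= 1} psi[x_u] z_u; for psi = phi, eta, R this is M, eta, R. *)
Definition genfun (K : comNzRingType) (d : nat) (psi : {scalar ncpoly K d}) :
    ncseries K d :=
  NCSeries (fun w => if w is [::] then 0 else psi (\prod_(i <- w) ncX K i)).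

Definition interval_partitions (n : nat) : {set {set {set 'I_n}}} :=
  [set P | partition P [set: 'I_n] &
    [forall B in P, [forall i in B, [forall k in B, [forall j : 'I_n,
      (i <= j <= k)%N ==> (j \in B)]]]]].

Definition noncrossing_partitions (n : nat) : {set {set {set 'I_n}}} :=
  [set P | partition P [set: 'I_n] &
    [forall B in P, [forall C in P,
      [exists i in B, [exists j in C, [exists k in B, [exists l in C,
        [&& i < j, j < k & k < l]%N]]]] ==> (B == C)]]].

(** The products [\prod_(i in B) ncX K (u i)] in K<x> are taken in increasing
  order of [i], the enumeration order of ['I_n]. *)
Definition boolean_cumulant (K : comNzRingType) (d : nat)
    (phi eta : {scalar ncpoly K d}) : Prop :=
  eta 1 = 0 /\
  forall (n : nat) (u : 'I_n -> 'I_d), (1 <= n)%N ->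
    phi (\prod_(i < n) ncX K (u i)) =
      \sum_(P in interval_partitions n)
        \prod_(B in P) eta (\prod_(i in B) ncX K (u i)).

Definition free_cumulant (K : comNzRingType) (d : nat)
    (phi R : {scalar ncpoly K d}) : Prop :=
  R 1 = 0 /\
  forall (n : nat) (u : 'I_n -> 'I_d), (1 <= n)%N ->
    phi (\prod_(i < n) ncX K (u i)) =
      \sum_(P in noncrossing_partitions n)
        \prod_(B in P) R (\prod_(i in B) ncX K (u i)).

(* Main.v *)
Require Import Defs.
From HB Require Import structures.
From mathcomp Require Import all_boot all_order all_algebra.
From mathcomp Require Import boolp reals complex.
From mathcomp.multinomials Require Import monalg.

Set Implicit Arguments.
Unset Strict Implicit.
Unset Printing Implicit Defensive.

Import GRing.Theory.
Local Open Scope ring_scope.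
Local Open Scope complex_scope.

(** Put A = 1 + M(V).  Everything rests on two expressions for A.

  The first is A = 1 + R(U).  The two relations between U and V read
  U_i = A V_i and U_i = (1 + R(U)) V_i, so (A - (1 + R(U))) V_i = 0 for every i.
  Series in non-commuting indeterminates over a field have no zero divisors
  ([ncmul_eq0]), so A = 1 + R(U) as soon as one V_i is nonzero; if all of them
  vanish, so do all the U_i, and then M(V) = R(U) = 0.

  The second is A = (1 - eta(V))^-1.  Removing the block of the first letter
  from an interval partition gives M = eta + eta M, that is
  (1 - eta)(1 + M) = 1 ([boolean_moment_cumulant]), and substituting V is a ring
  morphism ([ncsubstM]).

  Since the coefficients of A are scalars, A commutes with the x_i, and the
  first expression gives
    1 - x . U + R(U) = A - x . (A V) = A (1 - x . V).
  Inverting both sides and using the second expression for A^-1 gives the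
  claim. *)

(** * Interval partitions of a final segment *)

Section IntervalPartitions.
Variable n : nat.
Implicit Types (i j k m : 'I_n) (B D : {set 'I_n}) (P Q : {set {set 'I_n}}).

Definition ord_from (a : nat) : {set 'I_n} := [set i : 'I_n | a <= i]%N.

Definition ord_segment (a b : nat) : {set 'I_n} := [set i : 'I_n | a <= i <= b]%N.

(** [interval_partitions n] is the case [D = setT], by conversion.  The sets that
  occur below are the final segments [ord_from a] of a fixed 'I_n, so that
  removing the first block does not change the index type. *)
Definition interval_partitions_of D : {set {set {set 'I_n}}} :=
  [set P | partition P D &
    [forall B in P, [forall i in B, [forall k in B, [forall j : 'I_n,
      (i <= j <= k)%N ==> (j \in B)]]]]].

Lemma interval_partitions_ofP D P :
  reflect (partition P D /\ forall B i j k, B \in P -> i \in B -> k \in B ->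
             (i <= j <= k)%N -> j \in B)
          (P \in interval_partitions_of D).
Proof.
rewrite inE; apply: (iffP andP) => -[Ppart Pconv]; split=> //.
  move=> B i j k BP iB kB ijk.
  move/forall_inP: Pconv => /(_ B BP) /forall_inP /(_ i iB).
  by move=> /forall_inP /(_ k kB) /forallP /(_ j) /implyP; apply.
apply/forall_inP => B BP; apply/forall_inP => i iB; apply/forall_inP => k kB.
by apply/forallP => j; apply/implyP; apply: Pconv iB kB.
Qed.

Lemma interval_partitions_of_set0 : interval_partitions_of set0 = [set set0].
Proof.
apply/setP => P; rewrite !inE partition_set0.
by case: eqP => //= ->; apply/forall_inP => B; rewrite inE.
Qed.

(** The block of the least element [m] ends at its greatest element [k], and
  convexity fills in everything between. *)
Lemma first_block m P : P \in interval_partitions_of (ord_from m) ->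
  exists2 k : 'I_n, (m <= k)%N & pblock P m = ord_segment m k.
Proof.
case/interval_partitions_ofP => Ppart Pconv.
have covP := cover_partition Ppart.
have m_cov : m \in cover P by rewrite covP inE.
have BP : pblock P m \in P by rewrite pblock_mem.
have mB : m \in pblock P m by rewrite mem_pblock.
case: (@arg_maxnP _ m [pred i | i \in pblock P m] (fun i => i : nat)) => //= k kB kmax.
have Bge i : i \in pblock P m -> (m <= i)%N.
  move=> iB; have : i \in cover P by apply/bigcupP; exists (pblock P m).
  by rewrite covP inE.
exists k; first exact: Bge.
apply/setP => i; rewrite inE; apply/idP/idP => [iB|mik].
  by rewrite Bge //= kmax.
exact: Pconv BP mB kB mik.
Qed.

Lemma ord_segment_inj m : {in ord_from m &, injective (ord_segment m \o val)}.
Proof.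
move=> k k'; rewrite !inE => mk mk' /setP eqk; apply/val_inj/eqP.
move: (eqk k) (eqk k'); rewrite !inE mk mk' !leqnn /= => /esym le1 le2.
by rewrite eqn_leq le1 le2.
Qed.

Lemma segment_setU m k : (m <= k)%N ->
  ord_segment m k :|: ord_from k.+1 = ord_from m.
Proof.
move=> mk; apply/setP => i; rewrite !inE ltnNge.
case: (leqP i k) => [ik|ki] /=; first by rewrite andbT orbF.
by rewrite andbF (leq_trans mk (ltnW ki)).
Qed.

Lemma segment_disjoint m k : [disjoint ord_segment m k & ord_from k.+1].
Proof.
rewrite -setI_eq0; apply/eqP/setP => i; rewrite !inE ltnNge.
by case: (leqP i k); rewrite ?andbF ?andbT.
Qed.

Lemma segment_mem m k : (m <= k)%N -> m \in ord_segment m k.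
Proof. by move=> mk; rewrite inE leqnn. Qed.

Lemma segment_notin m k Q : (m <= k)%N ->
  Q \in interval_partitions_of (ord_from k.+1) -> ord_segment m k \notin Q.
Proof.
move=> mk /interval_partitions_ofP [Qpart _]; apply/negP => SQ.
have : m \in ord_from k.+1.
  rewrite -(cover_partition Qpart); apply/bigcupP.
  by exists (ord_segment m k); rewrite ?segment_mem.
by rewrite inE ltnNge mk.
Qed.

Lemma interval_partitions_cons m k Q : (m <= k)%N ->
    ord_segment m k \notin Q ->
  (ord_segment m k |: Q \in interval_partitions_of (ord_from m)) =
  (Q \in interval_partitions_of (ord_from k.+1)).
Proof.
move=> mk SQ; apply/interval_partitions_ofP/interval_partitions_ofP.
  case=> Ppart Pconv; split; last first.
    by move=> B i j k' BQ; apply: Pconv; rewrite inE BQ orbT.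
  have := partitionD1 Ppart (setU11 _ _).
  rewrite setU1K // -(segment_setU mk) setDUl setDv set0U.
  suff -> : ord_from k.+1 :\: ord_segment m k = ord_from k.+1 by [].
  by apply/setDidPl; rewrite disjoint_sym segment_disjoint.
case=> Qpart Qconv; split.
  rewrite -(segment_setU mk); apply: partitionU1 => //; last exact: segment_disjoint.
  by apply/set0Pn; exists m; apply: segment_mem.
move=> B i j k'; rewrite inE => /orP [/set1P ->|]; last exact: Qconv.
rewrite !inE => /andP [mi _] /andP [_ k'k] /andP [ij jk'].
by rewrite (leq_trans mi ij) (leq_trans jk' k'k).
Qed.

(** An interval partition of {m, ..., n-1} amounts to its first block
  {m, ..., k} and an interval partition of the remaining {k+1, ..., n-1}. *)
Lemma sum_interval_partitions_rec (K : comNzRingType) (wt : {set 'I_n} -> K) m :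
  \sum_(P in interval_partitions_of (ord_from m)) \prod_(B in P) wt B =
  \sum_(k : 'I_n | (m <= k)%N) wt (ord_segment m k) *
     \sum_(Q in interval_partitions_of (ord_from k.+1)) \prod_(B in Q) wt B.
Proof.
(* Sort the partitions by the block of [m], then by the end [k] of that block. *)
rewrite (partition_big (fun P => pblock P m)
  [in [set (ord_segment m \o val) k | k in ord_from m]]) /=; last first.
  move=> P /first_block [k mk ->].
  by apply/imsetP; exists k; rewrite ?inE.
rewrite big_imset /=; last exact: ord_segment_inj.
under eq_bigl do rewrite inE.
apply: eq_bigr => k mk; rewrite mulr_sumr.
rewrite (reindex_onto (fun Q => ord_segment m k |: Q)
           (fun P => P :\ ord_segment m k)) /=.
  apply: eq_big => [Q|Q /andP [/andP[_ _] /eqP QK]]; last first.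
    by rewrite big_setU1 //= -QK !inE eqxx.
  apply/idP/idP => [/andP [/andP[Pin _] /eqP QK]|Qin].
    by rewrite -(interval_partitions_cons mk) // -QK setD11.
  have SQ := segment_notin mk Qin.
  have Pin : ord_segment m k |: Q \in interval_partitions_of (ord_from m).
    by rewrite interval_partitions_cons.
  rewrite Pin setU1K // eqxx andbT /=.
  case/interval_partitions_ofP: Pin => /and3P [_ tP _] _.
  by rewrite (def_pblock tP (setU11 _ _)) ?segment_mem.
move=> P /andP [/interval_partitions_ofP [Ppart _] /eqP PS].
by rewrite setD1K // -PS pblock_mem // (cover_partition Ppart) inE.
Qed.
End IntervalPartitions.

(** * The algebra of non-commutative power series *)

Section Series.
Variable d : nat.
Implicit Types (w u v : seq 'I_d) (a : 'I_d).

Section Ring.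
Variable A : nzRingType.
Implicit Types f g : ncseries A d.

(** The left quotient of [f] by the letter [a]: every series is its constant term
  plus the sum of the z_a times [ncshift a f].  The induction proving [ncsubstM]
  goes through this decomposition. *)
Definition ncshift a f : ncseries A d := NCSeries (fun w => f (a :: w)).

Lemma ncaddE f g w : (f + g) w = f w + g w. Proof. by []. Qed.
Lemma ncoppE f w : (- f) w = - f w. Proof. by []. Qed.
Lemma ncmulE f g w :
  (f * g) w = \sum_(k < (size w).+1) f (take k w) * g (drop k w).
Proof. by []. Qed.
Lemma ncsumE (I : Type) (r : seq I) (P : pred I) (F : I -> ncseries A d) w :
  (\sum_(i <- r | P i) F i) w = \sum_(i <- r | P i) F i w.
Proof. exact: (big_morph (fun f : ncseries A d => f w)). Qed.

Lemma ncmul_nil f g : (f * g) [::] = f [::] * g [::].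
Proof. by rewrite ncmulE big_ord1. Qed.

Lemma ncconstME c f w : (ncconst d c * f) w = c * f w.
Proof.
rewrite ncmulE big_ord_recl take0 drop0 /= big1 ?addr0 // => k _.
by case: w k => [|a w] k; [case: k | rewrite mul0r].
Qed.

Lemma ncMconstE c f w : (f * ncconst d c) w = f w * c.
Proof.
rewrite ncmulE big_ord_recr take_size drop_size /= big1 ?add0r // => k _.
case dk: drop => [|a v]; last by rewrite mulr0.
by move/(congr1 size): dk; rewrite size_drop => /eqP; rewrite subn_eq0 leqNgt ltn_ord.
Qed.

Lemma ncconst_comm c f :
  (forall w, c * f w = f w * c) -> ncconst d c * f = f * ncconst d c.
Proof. by move=> cf; apply: ncseriesP => w; rewrite ncconstME ncMconstE. Qed.

Lemma ncshiftM a f g :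
  ncshift a (f * g) = ncconst d (f [::]) * ncshift a g + ncshift a f * g.
Proof.
apply: ncseriesP => w; rewrite ncaddE ncconstME.
by rewrite [LHS]ncmulE big_ord_recl take0 drop0.
Qed.

End Ring.

(** Take [v] of minimal length with g_v nonzero.  If f vanishes on all words
  shorter than w, then the only factorization of w v contributing to (f g)_{wv}
  is the one cut between w and v, so f_w g_v = 0: shorter left factors are
  killed by f, longer ones leave a right factor too short for g. *)
Lemma ncmul_eq0 (A : idomainType) (f g : ncseries A d) :
  f * g = 0 -> g != 0 -> f = 0.
Proof.
move=> fg0 g_neq0.
have [v gv vmin] :
    exists2 v, g v != 0 & forall w, (size w < size v)%N -> g w = 0.
  have ex : exists n, `[< exists2 v, size v = n & g v != 0 >].
    have [v gv] : exists v, g v != 0.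
      apply: contrapT => g0; case/eqP: g_neq0; apply: ncseriesP => v.
      by apply/eqP/negPn/negP => gv; apply: g0; exists v.
    by exists (size v); apply/asboolP; exists v.
  case: (ex_minnP ex) => l /asboolP [v sv gv] lmin; exists v => // w.
  by apply: contraTeq => gw; rewrite -leqNgt sv; apply: lmin; apply/asboolP; exists w.
apply: ncseriesP => w; have [n] := ubnP (size w); elim: n w => // n IH w /ltnSE le_wn.
have : (f * g) (w ++ v) = 0 by rewrite fg0.
have lt_w : (size w < (size (w ++ v)).+1)%N by rewrite ltnS size_cat leq_addr.
rewrite ncmulE (bigD1 (Ordinal lt_w)) //= take_size_cat // drop_size_cat //.
rewrite big1 ?addr0 => [/eqP|k neq_k].
  by rewrite mulf_eq0 (negPf gv) orbF => /eqP.
have [lt_kw|le_wk] := ltnP k (size w).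
  rewrite IH ?mul0r //; apply: leq_trans le_wn; apply: leq_ltn_trans lt_kw.
  by rewrite size_take_min geq_minl.
rewrite vmin ?mulr0 //.
have lt_wk : (size w < k)%N.
  by rewrite ltn_neqAle le_wk andbT; apply: contra neq_k => /eqP e; apply/eqP/val_inj.
have : (size w + size v < size v + k)%N by rewrite addnC ltn_add2l.
by rewrite -size_cat => lt_cat; rewrite size_drop -(ltn_add2r k) subnK // -ltnS.
Qed.

(** * Substitution of series without constant term *)

Section Subst.
Variables (K : comNzRingType) (U : 'I_d -> ncseries K d).
Hypothesis U0 : forall a, U a [::] = 0.
Implicit Types f g : ncseries K d.

Lemma ncsubst_nil f : ncsubst f U [::] = f [::].
Proof.
rewrite /= big_ord1 (big_pred1 [tuple]) => [|t].
  by rewrite big_nil mulr1.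
by apply/esym/eqP/val_inj; case: t => -[].
Qed.

(** Grouping the monomials of [f] by their first letter gives the recursion that
  replaces the truncated sum defining f(U) in the arguments below. *)
Lemma ncsubst_expand f :
  ncsubst f U = ncconst d (f [::]) + \sum_a U a * ncsubst (ncshift a f) U.
Proof.
(* Cut one length later than needed: the nonempty words [a :: t] then have tails
   [t] of all lengths up to [size w], the cut used for [ncshift a f]. *)
apply: ncseriesP => w; rewrite (ncsubst_stable f U0 (ltnW (ltnSn _.+1))).
rewrite big_ord_recl ncaddE; congr (_ + _).
  rewrite (big_pred1 [tuple]) => [|t]; last by apply/esym/eqP/val_inj; case: t => -[].
  by rewrite big_nil; case: w => [|a w]; rewrite /= ?mulr1 ?mulr0.
rewrite ncsumE; under eq_bigr => n _.
  rewrite (reindex (fun p : 'I_d * n.-tuple 'I_d => cons_tuple p.1 p.2)) /=; last first.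
    exists (fun t : n.+1.-tuple 'I_d => (thead t, behead_tuple t)) => [[a t] _|t _] /=.
      by congr (_, _); apply: val_inj.
    by rewrite [RHS]tuple_eta; apply: val_inj.
  rewrite -(pair_bigA _ (fun a (t : n.-tuple 'I_d) =>
              f (a :: t) * (\prod_(i <- a :: t) U i) w)) /=.
  over.
rewrite exchange_big; apply: eq_bigr => a _.
rewrite ncmulE; under [RHS]eq_bigr => k _.
  rewrite (ncsubst_stable _ U0 (_ : size (drop k w) < (size w).+1)%N); last first.
    by rewrite ltnS size_drop leq_subr.
  rewrite mulr_sumr; over.
rewrite exchange_big; apply: eq_bigr => n _.
under [RHS]eq_bigr do rewrite mulr_sumr.
rewrite exchange_big; apply: eq_bigr => t _.
rewrite big_cons ncmulE mulr_sumr; apply: eq_bigr => k _.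
by rewrite mulrCA.
Qed.

Lemma ncsubstD f g : ncsubst (f + g) U = ncsubst f U + ncsubst g U.
Proof.
apply: ncseriesP => w /=; rewrite -big_split; apply: eq_bigr => n _ /=.
by rewrite -big_split; apply: eq_bigr => u _; rewrite mulrDl.
Qed.

Lemma ncsubstN f : ncsubst (- f) U = - ncsubst f U.
Proof.
apply: ncseriesP => w /=; rewrite -sumrN; apply: eq_bigr => n _ /=.
by rewrite -sumrN; apply: eq_bigr => u _; rewrite mulNr.
Qed.

Lemma ncsubstC c : ncsubst (ncconst d c) U = ncconst d c.
Proof.
rewrite ncsubst_expand big1 ?addr0 // => a _.
suff -> : ncshift a (ncconst d c) = 0.
  suff -> : ncsubst (0 : ncseries K d) U = 0 by rewrite mulr0.
  by apply: (addrI (ncsubst 0 U)); rewrite -ncsubstD !addr0.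
by apply: ncseriesP.
Qed.

Lemma ncsubstZ c f : ncsubst (ncconst d c * f) U = ncconst d c * ncsubst f U.
Proof.
apply: ncseriesP => w; rewrite ncconstME mulr_sumr; apply: eq_bigr => n _.
by rewrite mulr_sumr; apply: eq_bigr => u _; rewrite ncconstME mulrA.
Qed.

(** By [ncsubst_expand] and [ncshiftM], the defect (f g)(U) - f(U) g(U) is the sum
  over the letters a of U_a times the defect of the pair [ncshift a f], [g].  As
  U_a has no constant term, vanishing of the defects on words shorter than w
  gives vanishing at w. *)
Lemma ncsubstM f g : ncsubst (f * g) U = ncsubst f U * ncsubst g U.
Proof.
apply: ncseriesP => w; have [n] := ubnP (size w).
elim: n w f => // n IH w f /ltnSE le_wn.
rewrite [in LHS]ncsubst_expand [ncsubst f U]ncsubst_expand mulrDl mulr_suml.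
rewrite {1}(ncsubst_expand g) mulrDr mulr_sumr -addrA -big_split.
rewrite 2!ncaddE; congr (_ + _).
  by rewrite ncconstME ncmul_nil; case: w le_wn => [|a w] _ //=; rewrite mulr0.
rewrite !ncsumE; apply: eq_bigr => a _.
rewrite ncshiftM ncsubstD ncsubstZ mulrDr !ncaddE; congr (_ + _).
  rewrite !mulrA; congr (ncoef (_ * _) w).
  by apply: ncseriesP => u; rewrite ncconstME ncMconstE mulrC.
(* The term k = 0 vanishes with U_a(0); the others involve shorter words. *)
rewrite -mulrA !ncmulE; apply: eq_bigr => -[[|k] lt_k] _.
  by rewrite take0 U0 !mul0r.
rewrite IH // size_drop; apply: leq_trans le_wn.
by rewrite ltn_subrL (leq_trans _ (lt_k : (k < size w)%N)).
Qed.

End Subst.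

(** * Scalar series inside K<x><<z>> *)

Section Lift.
Variable K : comNzRingType.
Implicit Types f g : ncseries K d.

Lemma ncliftD f g : nclift (f + g) = nclift f + nclift g.
Proof. by apply: ncseriesP => w /=; rewrite raddfD. Qed.

Lemma ncliftB f g : nclift (f - g) = nclift f - nclift g.
Proof. by apply: ncseriesP => w /=; rewrite raddfB. Qed.

Lemma nclift1 : nclift (1 : ncseries K d) = 1.
Proof. by apply: ncseriesP => -[|a w]; rewrite [LHS]/= ?mpolyC1E ?malgC0E. Qed.

Lemma ncliftM f g : nclift (f * g) = nclift f * nclift g.
Proof.
apply: ncseriesP => w /=; rewrite raddf_sum; apply: eq_bigr => k _.
by rewrite /= mpolyCM.
Qed.

Lemma ncX_comm (c : K) a : ncX K a * c%:MP = c%:MP * ncX K a.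
Proof. by rewrite !malgM_def !fgmulUU mulr1 mul1r mulm1 mul1m. Qed.

(** The scalar coefficients of [f] commute with the x_i, so [f] can be moved to
  the left of them. *)
Lemma ncdotM f (U : 'I_d -> ncseries K d) :
  ncdot (fun i => f * U i) = nclift f * ncdot U.
Proof.
rewrite /ncdot mulr_sumr; apply: eq_bigr => i _.
rewrite ncliftM mulrA [RHS]mulrA.
have fX := ncconst_comm (f := nclift f) (fun w => ncX_comm (f w) i).
exact: (congr1 (fun h => h * nclift (U i)) fX).
Qed.

Lemma ncdot_nil (U : 'I_d -> ncseries K d) :
  (forall i, U i [::] = 0) -> ncdot U [::] = 0.
Proof.
by move=> U0; rewrite ncsumE big1 // => i _; rewrite ncconstME /= U0 raddf0 mulr0.
Qed.
End Lift.

(** * Moments and Boolean cumulants *)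

Section Boolean.
Variables (K : comNzRingType) (phi eta : {scalar ncpoly K d}).
Hypothesis etaP : boolean_cumulant phi eta.

Lemma prod_segment w (m k : 'I_(size w)) :
  \prod_(i in ord_segment (size w) m k) ncX K (tnth (in_tuple w) i) =
  \prod_(i <- take (k.+1 - m) (drop m w)) ncX K i.
Proof.
pose x0 := tnth (in_tuple w) m.
rewrite -(map_nth_iota x0) ?leq_sub2r // big_map.
rewrite -[iota _ _]/(index_iota m k.+1) (big_nat_widen _ _ (size w)) //.
rewrite (big_nat_widenl m 0) //.
rewrite big_mkord; apply: eq_big => [i|i _]; last by rewrite (tnth_nth x0).
by rewrite inE /= ltnS andbC.
Qed.

(** Both sides satisfy the same recursion: on the left by removing the first
  block, on the right because h = 1 + eta h.  A general start [a] is what the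
  recursion needs; the moments are the case [a = 0]. *)
Lemma sum_interval_partitionsE (h : ncseries K d) w (a : nat) :
    (1 - genfun eta) * h = 1 -> (a <= size w)%N ->
  \sum_(P in interval_partitions_of (ord_from (size w) a))
     \prod_(B in P) eta (\prod_(i in B) ncX K (tnth (in_tuple w) i)) =
  h (drop a w).
Proof.
move=> hE.
have {}hE : h = 1 + genfun eta * h by rewrite -hE mulrBl mul1r subrK.
have [r] := ubnP (size w - a); elim: r a => // r IH a lt_r.
rewrite leq_eqVlt => /predU1P [->|lt_a].
  have -> : ord_from (size w) (size w) = set0.
    by apply/setP => i; rewrite !inE leqNgt ltn_ord.
  rewrite interval_partitions_of_set0 big_set1 big_set0 drop_size.
  by rewrite hE ncaddE ncmul_nil mul0r addr0.
rewrite (sum_interval_partitions_rec _ (Ordinal lt_a)) /=.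
pose F k := genfun eta (take (k.+1 - a) (drop a w)) * h (drop k.+1 w).
transitivity (\sum_(k < size w | (a <= k)%N) F k).
  apply: eq_bigr => k ak; rewrite IH //; last first.
    apply: (leq_trans _ (lt_r : (size w - a <= r)%N)).
    by rewrite ltn_sub2l // ltnS.
  rewrite (prod_segment (Ordinal lt_a)) /F; congr (_ * _).
  (* The block is nonempty, so [genfun eta] takes the value of [eta] on it. *)
  rewrite /=; case dt: take => //.
  move/(congr1 size): dt; rewrite size_takel ?size_drop ?leq_sub2r //.
  by rewrite subSn.
rewrite -(big_mkord (fun k => true && (a <= k))%N) -(big_nat_widenl a 0 _ xpredT) //.
rewrite -{1}(add0n a) big_addn [in RHS]hE ncaddE ncmulE big_ord_recl take0 mul0r add0r.
have -> : (1 : ncseries K d) (drop a w) = 0.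
  by case da : (drop a w) => //; move: lt_a; rewrite -subn_gt0 -size_drop da.
rewrite add0r size_drop big_mkord; apply: eq_bigr => j _.
by rewrite /F -addSn addnK drop_drop addSn.
Qed.

Lemma boolean_moment_cumulant : (1 - genfun eta) * (1 + genfun phi) = 1.
Proof.
have unit_eta : 1 - genfun eta \is a GRing.unit.
  by apply: ncunit_const1; rewrite ncaddE ncoppE subr0.
suff -> : 1 + genfun phi = (1 - genfun eta)^-1 by rewrite divrr.
apply: ncseriesP => w; case: w => [|b w].
  have /(congr1 (fun h : ncseries K d => h [::])) := divrr unit_eta.
  by rewrite ncmul_nil !ncaddE ncoppE oppr0 !addr0 mul1r.
set v := b :: w.
rewrite -[v in RHS]drop0 -sum_interval_partitionsE ?divrr //.
have -> : ord_from (size v) 0 = setT by apply/setP => i; rewrite !inE.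
rewrite -etaP.2 // ncaddE add0r /= -/v.
by rewrite -(big_tuple _ _ (in_tuple v) xpredT).
Qed.
End Boolean.
End Series.

(** * The resolvent identity *)

Theorem proposition5 (Rr : realType) (d : nat)
    (phi eta R : {scalar ncpoly Rr[i] d})
    (phi1 : phi 1 = 1)
    (etaP : boolean_cumulant phi eta)
    (RP : free_cumulant phi R)
    (U V : 'I_d -> ncseries Rr[i] d)
    (U0 : forall i, U i [::] = 0)
    (V0 : forall i, V i [::] = 0)
    (UV : forall i, U i = (1 + ncsubst (genfun phi) V) * V i)
    (VU : forall i, V i = (1 + ncsubst (genfun R) U)^-1 * U i) :
  (1 - ncdot U + nclift (ncsubst (genfun R) U))^-1 =
    (1 - ncdot V)^-1 * (1 - nclift (ncsubst (genfun eta) V)).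
Proof.
have RU1 : 1 + ncsubst (genfun R) U \is a GRing.unit.
  by apply: ncunit_const1; rewrite ncaddE ncsubst_nil addr0.
have MR : ncsubst (genfun phi) V = ncsubst (genfun R) U.
  have [/existsP [i Vi]|/existsPn V_eq0] := boolP [exists i, V i != 0].
    have : (1 + ncsubst (genfun phi) V) * V i = (1 + ncsubst (genfun R) U) * V i.
      by rewrite -UV VU mulVKr.
    move/eqP; rewrite -subr_eq0 -mulrBl [1 + _]addrC addrKA => /eqP /ncmul_eq0.
    by move=> /(_ Vi) /eqP; rewrite subr_eq0 => /eqP.
  have {}V_eq0 i : V i = 0 by apply/eqP/negPn/V_eq0.
  have U_eq0 i : U i = 0 by rewrite UV V_eq0 mulr0.
  rewrite !ncsubst_expand // !big1 // => i _.
    by rewrite U_eq0 mul0r.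
  by rewrite V_eq0 mul0r.
have one_ncsubst (f : ncseries Rr[i] d) : 1 + ncsubst f V = ncsubst (1 + f) V.
  by rewrite ncsubstD (ncsubstC V0).
set a := 1 + ncsubst (genfun phi) V in UV.
have aV : (1 - ncsubst (genfun eta) V) * a = 1.
  rewrite /a one_ncsubst -ncsubstN one_ncsubst -ncsubstM //.
  by rewrite boolean_moment_cumulant // (ncsubstC V0).
have a_unit : nclift a \is a GRing.unit.
  have a1 : a [::] = 1 by rewrite ncaddE ncsubst_nil addr0.
  by apply: ncunit_const1; rewrite -mpolyC1E -a1.
have a_inv : (nclift a)^-1 = 1 - nclift (ncsubst (genfun eta) V).
  by apply: (mulIr a_unit); rewrite mulVr // -nclift1 -ncliftB -ncliftM aV.
have -> : 1 - ncdot U + nclift (ncsubst (genfun R) U) = nclift a * (1 - ncdot V).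
  rewrite mulrBr mulr1 -ncdotM -(funext UV) /a ncliftD nclift1 MR.
  by rewrite addrAC.
have x_unit : 1 - ncdot V \is a GRing.unit.
  by apply: ncunit_const1; rewrite ncaddE ncoppE ncdot_nil // subr0.
by rewrite -a_inv; apply: invrM a_unit x_unit.
Qed.
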